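(* Let $u,k$ be integers with $0\le u\le k$, $k\ge 1$ and $\gcd(u,k)=1$. Then there is exactly one fundamental Bhaskara pair $\{a,b\}$ with $b$ a positive integer and $a/b=u/k$. This pair is given explicitly as follows. For each prime $p$, let - $c_p$ be the exponent of $p$ in $u^2+k^2$, - $d_p$ be the exponent of $p$ in $u^3+k^3$, - $k_p$ be the exponent of $p$ in $k$. Define $T(c,d)$ for $c\in\{0,1,2\}$ and $d\in\{0,1\}$ by $$T(0,0)=0,\quad T(0,1)=3,\quad T(1,0)=4,\quad T(1,1)=1,\quad T(2,0)=2,\quad T(2,1)=5.$$ Then $$b=\prod_p p^{\,k_p+T(c_p \bmod 3,\; d_p \bmod 2)}\qquad\text{and}\qquad a=ub/k.$$ Here $k\mid b$, so $a$ is an integer.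
   Context: A Bhaskara pair is a pair $\{a,b\}$ of integers for which there exist integers $x,y$ with $a^2+b^2=x^3$ and $a^3+b^3=y^2$. A Bhaskara pair $\{a,b\}$ is called fundamental if there is no prime $p$ such that $p^6\mid a$ and $p^6\mid b$. *)

(* Defs.v *)
From mathcomp Require Import all_boot all_order all_algebra.

Set Implicit Arguments.
Unset Strict Implicit.
Unset Printing Implicit Defensive.

Import Order.TTheory GRing.Theory Num.Theory.
Local Open Scope ring_scope.

(* Symmetric in a and b, so this is a property of the unordered pair {a, b}. *)
Definition bhaskara_pair (a b : int) : Prop :=
  exists x y : int, a ^+ 2 + b ^+ 2 = x ^+ 3 /\ a ^+ 3 + b ^+ 3 = y ^+ 2.

Definition fundamental_bhaskara_pair (a b : int) : Prop :=
  bhaskara_pair a b /\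
  ~ (exists p : nat, [/\ prime p, ((p ^ 6)%N %| a)%Z & ((p ^ 6)%N %| b)%Z]).

Definition bhaskara_pair_of_ratio (u k a b : int) : Prop :=
  [/\ fundamental_bhaskara_pair a b, 0 < b
    & a%:~R / b%:~R = u%:~R / k%:~R :> rat].

(* Only the values for c < 3 and d < 2 are meaningful. *)
Definition exponent_table (c d : nat) : nat :=
  match c, d with
  | 0, 0 => 0
  | 0, 1 => 3
  | 1, 0 => 4
  | 1, 1 => 1
  | 2, 0 => 2
  | 2, 1 => 5
  | _, _ => 0
  end%N.

Definition exponent_of (p : nat) (z : int) : nat := logn p `|z|%N.

Definition b_exponent (u k : int) (p : nat) : nat :=
  (exponent_of p k
   + exponent_table (exponent_of p (u ^+ 2 + k ^+ 2)%R %% 3)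
                    (exponent_of p (u ^+ 3 + k ^+ 3)%R %% 2))%N.

Definition relevant_primes (u k : int) : seq nat :=
  primes `|(k * (u ^+ 2 + k ^+ 2) * (u ^+ 3 + k ^+ 3))%R|%N.

(* The product over all primes p of p ^ b_exponent u k p: when 0 <= u and
   0 < k, every prime outside relevant_primes u k contributes a factor 1, by
   b_exponent_eq0. *)
Definition explicit_b (u k : int) : int :=
  (\prod_(p <- relevant_primes u k) p ^ b_exponent u k p)%N%:Z.

Lemma b_exponent_eq0 (u k : int) (p : nat) :
  0 <= u -> 0 < k -> p \notin relevant_primes u k -> b_exponent u k p = 0%N.
Proof.
move=> u0 k0; rewrite /relevant_primes /b_exponent /exponent_of.
have s0 : 0 < u ^+ 2 + k ^+ 2 by rewrite ltr_wpDl ?exprn_ge0 ?exprn_gt0.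
have t0 : 0 < u ^+ 3 + k ^+ 3 by rewrite ltr_wpDl ?exprn_ge0 ?exprn_gt0.
rewrite !abszM !primesM ?muln_gt0 ?absz_gt0 ?gt_eqF //.
rewrite !negb_or -!logn_gt0 -!eqn0Ngt => /andP[/andP[/eqP -> /eqP ->] /eqP ->].
by [].
Qed.

(* Main.v *)
(* Since gcd(u, k) = 1, the pairs of ratio u/k with positive b are
   (u m, k m) for a positive integer m.  Such a pair is a Bhaskara pair iff
   m^2 (u^2 + k^2) is a cube and m^3 (u^3 + k^3) is a square, which prime by
   prime prescribes the exponent of p in m modulo 6; being fundamental means
   that this exponent is less than 6, so m is unique. *)

Require Import Defs.
From mathcomp Require Import all_boot all_order all_algebra.
From mathcomp Require Import zify ring.

Set Implicit Arguments.
Unset Strict Implicit.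
Unset Printing Implicit Defensive.

Import Order.TTheory GRing.Theory Num.Theory.
Local Open Scope ring_scope.

Lemma prod_primes_gt0 (s : seq nat) (f : nat -> nat) :
  all prime s -> (0 < \prod_(q <- s) q ^ f q)%N.
Proof.
move=> s_pr; rewrite big_seq; apply: prodn_cond_gt0 => q q_s.
by rewrite expn_gt0 prime_gt0 // (allP s_pr).
Qed.

Lemma logn_prod_primes (s : seq nat) (f : nat -> nat) (p : nat) :
  uniq s -> all prime s ->
  logn p (\prod_(q <- s) q ^ f q)%N = if p \in s then f p else 0%N.
Proof.
elim: s => [|q s IHs] /=; first by rewrite big_nil logn1.
case/andP=> q_s s_uniq /andP[q_pr s_pr].
rewrite big_cons lognM ?prod_primes_gt0 ?expn_gt0 ?prime_gt0 //.
rewrite IHs // lognX logn_prime // in_cons.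
have [->|_] := eqVneq p q; first by rewrite (negPf q_s) muln1 addn0.
by rewrite muln0.
Qed.

Lemma all_prime_primes (n : nat) : all prime (primes n).
Proof. by apply/allP=> p; rewrite mem_primes => /and3P[]. Qed.

(** [logn] vanishes at every non-prime, so agreement at primes is agreement everywhere. *)
Lemma eqn_from_prime_log (m n : nat) : (0 < m)%N -> (0 < n)%N ->
  (forall p, prime p -> logn p m = logn p n) -> m = n.
Proof.
move=> m_gt0 n_gt0 eq_log; apply: eqn_from_log => // p.
have [/eq_log //|p_npr] := boolP (prime p).
by rewrite lognE [RHS]lognE (negPf p_npr).
Qed.

Lemma Posz_expn (n e : nat) : (n ^ e)%N%:Z = n%:Z ^+ e.
Proof. by rewrite -!natz natrX. Qed.

Lemma exact_powerzP (e n : nat) : (0 < e)%N -> (0 < n)%N ->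
  (exists x : int, n%:Z = x ^+ e) <->
  (forall p, prime p -> (e %| logn p n)%N).
Proof.
move=> e_gt0 n_gt0; split=> [[x n_xe] p _|e_log].
  (* Passing to the absolute value covers a negative root [x] when [e] is even. *)
  have ->: n = (`|x| ^ e)%N by rewrite -abszX -n_xe.
  by rewrite lognX dvdn_mulr.
(* The candidate root: every prime exponent of [n] is divided by [e], which is exact by [e_log]. *)
pose r := (\prod_(q <- primes n) q ^ (logn q n %/ e))%N.
have r_gt0 : (0 < r)%N by rewrite prod_primes_gt0 ?all_prime_primes.
exists r%:Z; rewrite -Posz_expn; congr Posz.
apply: eqn_from_prime_log; rewrite ?expn_gt0 ?r_gt0 // => p p_pr.
rewrite lognX logn_prod_primes ?primes_uniq ?all_prime_primes //.
case: ifPn => [_|]; first by rewrite mulnC divnK ?e_log.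
by rewrite -logn_gt0 muln0 lt0n negbK => /eqP.
Qed.

(* Working modulo 2 and 3 determines l modulo 6, since 2 l + c = 0 (mod 3)
   means l = c (mod 3), and 3 l + d = 0 (mod 2) means l = d (mod 2). *)
Lemma exponent_tableP (c d l : nat) :
  ((3 %| 2 * l + c) && (2 %| 3 * l + d) && (l < 6))%N
  = (l == exponent_table (c %% 3) (d %% 2)).
Proof.
have: (c %% 3 < 3)%N by rewrite ltn_pmod.
have: (d %% 2 < 2)%N by rewrite ltn_pmod.
case Ec: (c %% 3)%N => [|[|[|//]]] _; case Ed: (d %% 2)%N => [|[|//]] _ /=.
all: apply/idP/idP; lia.
Qed.

(** The exponent prescribed for [p] in the multiplier [m] = b/k; adding the exponent of [p] in [k]
    gives [b_exponent]. *)
Definition scale_exponent (u k : int) (p : nat) : nat :=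
  exponent_table (exponent_of p (u ^+ 2 + k ^+ 2) %% 3)
                 (exponent_of p (u ^+ 3 + k ^+ 3) %% 2).

Section ScaledPair.

Variables u k : int.
Hypotheses (u_ge0 : 0 <= u) (k_gt0 : 0 < k).

Lemma sum_exprn_gt0 (e : nat) : 0 < u ^+ e + k ^+ e.
Proof. by rewrite ltr_wpDl ?exprn_ge0 ?exprn_gt0. Qed.

Lemma sum_powers_scaledE (e m : nat) :
  (u * m%:Z) ^+ e + (k * m%:Z) ^+ e = (m ^ e * `|(u ^+ e + k ^+ e)%R|)%N%:Z.
Proof.
rewrite PoszM Posz_expn gez0_abs ?(ltW (sum_exprn_gt0 e)) //.
by rewrite !exprMn; ring.
Qed.

(** The two sums equal m^2 (u^2 + k^2) and m^3 (u^3 + k^3), both positive, so [exact_powerzP] tests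
    each one prime by prime. *)
Lemma bhaskara_scaledP (m : nat) : (0 < m)%N ->
  bhaskara_pair (u * m%:Z) (k * m%:Z) <->
  (forall p, prime p ->
    (3 %| 2 * logn p m + exponent_of p (u ^+ 2 + k ^+ 2))%N &&
    (2 %| 3 * logn p m + exponent_of p (u ^+ 3 + k ^+ 3))%N).
Proof.
move=> m_gt0.
have abs_gt0 e : (0 < `|(u ^+ e + k ^+ e)%R|)%N.
  by rewrite absz_gt0 gt_eqF ?sum_exprn_gt0.
have prod_gt0 e : (0 < m ^ e * `|(u ^+ e + k ^+ e)%R|)%N.
  by rewrite muln_gt0 expn_gt0 m_gt0 abs_gt0.
have logE e p : logn p (m ^ e * `|(u ^+ e + k ^+ e)%R|)%N
              = (e * logn p m + exponent_of p (u ^+ e + k ^+ e))%N.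
  by rewrite lognM ?expn_gt0 ?m_gt0 ?abs_gt0 // lognX.
rewrite /bhaskara_pair !sum_powers_scaledE; split.
  case=> x [y [x3 y2]] p p_pr; rewrite -!logE.
  by apply/andP; split; apply: (exact_powerzP _ _).1 p_pr => //;
    [exists x | exists y].
move=> div_log.
have [|x x3] := (@exact_powerzP 3 _ isT (prod_gt0 2)).2.
  by move=> p /div_log/andP[]; rewrite logE.
have [|y y2] := (@exact_powerzP 2 _ isT (prod_gt0 3)).2.
  by move=> p /div_log/andP[]; rewrite logE.
by exists x, y.
Qed.

Hypothesis gcd_uk : gcdz u k = 1.

(** Coprimality gives gcd(u m, k m) = m. With [d] = p^6 this turns fundamentality into a condition
    on [m] alone. *)
Lemma dvdz_scaled_pair (d m : nat) :
  (d %| u * m%:Z)%Z && (d %| k * m%:Z)%Z = (d %| m)%N.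
Proof. by rewrite -dvdz_gcd -mulz_gcdl // gcd_uk mul1r. Qed.

Lemma fundamental_bhaskara_scaledP (m : nat) : (0 < m)%N ->
  fundamental_bhaskara_pair (u * m%:Z) (k * m%:Z) <->
  (forall p, prime p -> logn p m = scale_exponent u k p).
Proof.
move=> m_gt0; rewrite /fundamental_bhaskara_pair bhaskara_scaledP //; split.
  case=> div_log nsixth p p_pr; apply/eqP.
  rewrite /scale_exponent -exponent_tableP div_log //=.
  (* An exponent of at least 6 would mean that p^6 divides [m], hence both members of the pair. *)
  rewrite ltnNge -pfactor_dvdn //; apply/negP=> p6m; apply: nsixth.
  by exists p; move: p6m; rewrite -dvdz_scaled_pair => /andP[].
move=> logE; split=> [p p_pr|[p [p_pr p6a p6b]]].
  have /eqP := logE p p_pr.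
  by rewrite /scale_exponent -exponent_tableP => /andP[].
have /eqP := logE p p_pr; rewrite /scale_exponent -exponent_tableP => /andP[_].
by rewrite ltnNge -pfactor_dvdn // -dvdz_scaled_pair p6a p6b.
Qed.

(** Cross-multiplying gives a k = u b; as [k] is coprime to [u], Gauss's lemma yields k | b, and [m]
    is the quotient b/k. *)
Lemma ratio_scaledP (a b : int) : 0 < b ->
  a%:~R / b%:~R = u%:~R / k%:~R :> rat ->
  exists2 m : nat, (0 < m)%N & a = u * m%:Z /\ b = k * m%:Z.
Proof.
move=> b_gt0 /eqP.
rewrite eqr_div ?intr_eq0 ?lt0r_neq0 // -!intrM eqr_int => /eqP ak_ub.
have /dvdzP[m b_mk]: (k %| b)%Z.
  rewrite -(@Gauss_dvdzr k u) -?ak_ub ?dvdz_mull //.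
  by rewrite coprimez_sym /coprimez gcd_uk.
have m_gt0 : 0 < m by move: b_gt0; rewrite b_mk pmulr_lgt0.
exists `|m|%N; first by rewrite absz_gt0 gt_eqF.
rewrite gtz0_abs //; split; last by rewrite mulrC.
by apply: (mulIf (lt0r_neq0 k_gt0)); rewrite ak_ub b_mk mulrA.
Qed.

Lemma bhaskara_pair_of_ratioP (a b : int) :
  bhaskara_pair_of_ratio u k a b <->
  (exists m : nat, [/\ (0 < m)%N, a = u * m%:Z, b = k * m%:Z &
    forall p, prime p -> logn p m = scale_exponent u k p]).
Proof.
split=> [[fund b_gt0 /(ratio_scaledP b_gt0)[m m_gt0 [a_um b_km]]]|].
  exists m; split=> //; apply/fundamental_bhaskara_scaledP => //.
  by rewrite -a_um -b_km.
case=> m [m_gt0 -> -> logE]; split.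
- exact/fundamental_bhaskara_scaledP.
- by rewrite mulr_gt0.
- by rewrite !intrM -mulf_div divff ?mulr1 // intr_eq0 gt_eqF.
Qed.

Lemma bhaskara_pair_of_ratio_unique (a b a' b' : int) :
  bhaskara_pair_of_ratio u k a b -> bhaskara_pair_of_ratio u k a' b' ->
  (a, b) = (a', b').
Proof.
case/bhaskara_pair_of_ratioP=> m [m_gt0 -> -> m_log].
case/bhaskara_pair_of_ratioP=> m' [m'_gt0 -> -> m'_log].
suff -> : m = m' by [].
by apply: eqn_from_prime_log => // p p_pr; rewrite m_log ?m'_log.
Qed.

Lemma explicit_bE : exists m : nat,
  [/\ (0 < m)%N, explicit_b u k = k * m%:Z &
    forall p, prime p -> logn p m = scale_exponent u k p].
Proof.
pose s := relevant_primes u k.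
have s_uniq : uniq s by rewrite primes_uniq.
have s_pr : all prime s by rewrite all_prime_primes.
pose m := (\prod_(p <- s) p ^ scale_exponent u k p)%N.
have m_gt0 : (0 < m)%N by rewrite prod_primes_gt0.
(* As [b_exponent] is a sum of naturals, its vanishing outside [s] kills both summands. The finite
   products therefore have the prescribed exponent at every prime. *)
have off_s p : p \notin s ->
    exponent_of p k = 0%N /\ scale_exponent u k p = 0%N.
  move/(b_exponent_eq0 u_ge0 k_gt0)/eqP.
  by rewrite addn_eq0 => /andP[/eqP-> /eqP].
have m_log p : logn p m = scale_exponent u k p.
  by rewrite logn_prod_primes //; case: ifPn => // /off_s[].
have absk_gt0 : (0 < `|k|)%N by rewrite absz_gt0 gt_eqF.
exists m; split=> //.
(* Replacing [k] by its absolute value reduces the claim to naturals, where prime exponents can be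
   compared. *)
rewrite -[in RHS](gtz0_abs k_gt0) -PoszM; congr Posz.
apply: eqn_from_prime_log => [||p p_pr].
- by rewrite prod_primes_gt0.
- by rewrite muln_gt0 absk_gt0.
rewrite lognM // m_log logn_prod_primes //.
by case: ifPn => // /off_s[k_log ->]; rewrite addn0.
Qed.

End ScaledPair.

Theorem theorem3p8 (u k : int) (u_ge0 : 0 <= u) (u_le_k : u <= k)
    (k_ge1 : 1 <= k) (gcd_uk : gcdz u k = 1) :
  (exists! ab : int * int, bhaskara_pair_of_ratio u k ab.1 ab.2) /\
  (let b := explicit_b u k in
   let a := (u * b %/ k)%Z in
   (k %| b)%Z /\ bhaskara_pair_of_ratio u k a b).
Proof.
have k_gt0 : 0 < k by exact: lt_le_trans k_ge1.
have [m [m_gt0 b_km m_log]] := explicit_bE u_ge0 k_gt0.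
have ratio_m : bhaskara_pair_of_ratio u k (u * m%:Z) (k * m%:Z).
  by apply/bhaskara_pair_of_ratioP => //; exists m.
split.
  exists (u * m%:Z, k * m%:Z); split=> // -[a b] /=.
  exact: bhaskara_pair_of_ratio_unique.
rewrite /= b_km dvdz_mulr //; split=> //.
by rewrite mulrCA mulKz ?gt_eqF.
Qed.
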